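(* For every path $P_n$ with $n\geq 3$, $$3\leq C_s(P_n)\leq 4.$$
   Context: All graphs are finite, simple and undirected. $P_n$ denotes the path on $n$ vertices. $N(v)$ denotes the open neighborhood of a vertex $v$, and for $S\subseteq V(G)$ we write $\overline{S}=V(G)\setminus S$. A set $S\subseteq V(G)$ is a dominating set if every vertex of $\overline{S}$ is adjacent to a vertex of $S$. A dominating set $S$ is a super dominating set if for every $u\in\overline{S}$ there exists $v\in S$ with $N(v)\cap\overline{S}=\{u\}$. A super coalition partition of $G$ is a partition $\{A_1,\dots,A_k\}$ of $V(G)$ (into nonempty parts) such that (i) no part $A_i$ is a super dominating set of $G$, and (ii) for every part $A_i$ there is at least one distinct part $A_j$ ($j\neq i$) such that $A_i\cup A_j$ is a super dominating set of $G$. The super coalition number $C_s(G)$ is the maximum cardinality of a super coalition partition of $G$, with $C_s(G)=0$ if $G$ admits no super coalition partition. *)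

(* Defs.v *)
From mathcomp Require Import all_boot.

Set Implicit Arguments.
Unset Strict Implicit.
Unset Printing Implicit Defensive.

Record sgraph := SGraph {
  vertex :> finType;
  adj : rel vertex;
  adj_sym : symmetric adj;
  adj_irrefl : irreflexive adj }.

Definition nbh (G : sgraph) (v : G) : {set G} := [set u | adj v u].

Definition dominating (G : sgraph) (S : {set G}) : bool :=
  [forall u in ~: S, exists v in S, adj u v].

Definition super_dominating (G : sgraph) (S : {set G}) : bool :=
  dominating S &&
  [forall u in ~: S, exists v in S, nbh v :&: ~: S == [set u]].

Definition super_coalition_partition (G : sgraph) (P : {set {set G}}) : bool :=
  [&& partition P [set: G],
      [forall A in P, ~~ super_dominating A] &
      [forall A in P, exists B in P,
         (B != A) && super_dominating (A :|: B)]].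

(* An empty \max is 0, matching the convention for graphs that admit no super
   coalition partition. *)
Definition super_coalition_number (G : sgraph) : nat :=
  \max_(P : {set {set G}} | super_coalition_partition P) #|P|.

Definition path_adj (n : nat) : rel 'I_n :=
  fun i j => (i.+1 == j :> nat) || (j.+1 == i :> nat).

Lemma path_adj_sym (n : nat) : symmetric (@path_adj n).
Proof. by move=> i j; rewrite /path_adj orbC. Qed.

Lemma path_adj_irrefl (n : nat) : irreflexive (@path_adj n).
Proof. by move=> i; rewrite /path_adj orbb eqn_leq ltnn. Qed.

Definition path_graph (n : nat) : sgraph :=
  SGraph (@path_adj_sym n) (@path_adj_irrefl n).

(* Main.v *)
Require Import Defs.
From mathcomp Require Import all_boot.

(** Private neighbours inject the complement of a super dominating set S into
    S, so #|S| is at least half the order; hence, with five parts or more, two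
    disjoint coalition pairs would leave no room for the remaining parts.
    Pairwise intersecting coalition pairs covering at least five parts form a
    star.  If A is its center and u witnesses that A is not super dominating,
    then each leaf avoiding u uses its own neighbour of u, because a neighbour
    shared by two disjoint leaves would already serve A alone.  A star thus has
    at most 1 + 2 leaves in a path.  For the lower bound, split off the first
    two vertices of the path as singletons. *)

Lemma super_dominatingE (G : sgraph) (S : {set G}) :
  super_dominating S =
    [forall u in ~: S, exists v in S, nbh v :&: ~: S == [set u]].
Proof.
apply/andP/idP => [[] //|sdS]; split=> //.
apply/forall_inP => u uS.
have /exists_inP[v vS /eqP/setP/(_ u)] := forall_inP sdS u uS.
rewrite !inE eqxx => /andP[vu _].
by apply/exists_inP; exists v; rewrite // adj_sym.
Qed.

Lemma super_dominatingP (G : sgraph) (S : {set G}) :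
  reflect (forall u, u \notin S ->
             exists2 v, v \in S & nbh v :&: ~: S = [set u])
          (super_dominating S).
Proof.
rewrite super_dominatingE; apply: (iffP forall_inP) => sdS u.
  rewrite -in_setC => uS; have /exists_inP[v vS /eqP vu] := sdS u uS.
  by exists v.
rewrite in_setC => uS; have [v vS vu] := sdS u uS.
by apply/exists_inP; exists v; rewrite // vu.
Qed.

Lemma super_dominating_card (G : sgraph) (S : {set G}) :
  super_dominating S -> #|G| <= 2 * #|S|.
Proof.
move=> /super_dominatingP sdS.
rewrite -(cardsC S) mul2n -addnn leq_add2l.
(* The injection is counted backwards: [f] sends a private neighbour to the vertex it serves, so the
   image of [S] under [f] covers the complement. The default [v] only makes [f] total. *)
pose f v := odflt v [pick u in nbh v :&: ~: S].
apply: leq_trans (leq_imset_card f S).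
apply/subset_leq_card/subsetP => u; rewrite in_setC => /sdS[v vS vu].
apply/imsetP; exists v => //; rewrite /f vu.
by case: pickP => [w|/(_ u)]; rewrite inE ?eqxx // => /eqP->.
Qed.

Lemma disjoint_parts {T : finType} {P : {set {set T}}} {A B : {set T}} (x : T) :
  trivIset P -> A \in P -> B \in P -> x \in A -> x \in B -> A = B.
Proof.
move=> tP AP BP xA xB; apply/eqP; apply: contraTT xB => neqAB.
by rewrite (disjointFr (trivIsetP tP A B AP BP neqAB) xA).
Qed.

Definition coalition_partners (G : sgraph) (P : {set {set G}}) (A : {set G}) :=
  [set B in P | (B != A) && super_dominating (A :|: B)].

(** For a witness [u] that [A] is not super dominating, disjointness lets at most one partner
    contain [u]; the others inject into the at most [d] neighbours of [u]. *)
Lemma card_coalition_partners (G : sgraph) (d : nat) (P : {set {set G}})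
    (A : {set G}) :
  (forall v : G, #|nbh v| <= d) -> trivIset P -> ~~ super_dominating A ->
  #|coalition_partners G P A| <= d.+1.
Proof.
move=> degG tP; rewrite super_dominatingE => /forall_inPn[u].
rewrite in_setC => uA /exists_inPn no_v.
pose Q := coalition_partners G P A.
have uniq_u : #|[set B in Q | u \in B]| <= 1.
  apply/card_le1_eqP => B C; rewrite !inE.
  move=> /andP[/andP[BP _] uB] /andP[/andP[CP _] uC].
  exact: (disjoint_parts u tP CP BP uC uB).
pose Q' := [set B in Q | u \notin B].
pose f (B : {set G}) :=
  odflt u [pick v in A :|: B | nbh v :&: ~: (A :|: B) == [set u]].
have fP B : B \in Q' ->
    f B \in A :|: B /\ nbh (f B) :&: ~: (A :|: B) = [set u].
  rewrite !inE /f => /andP[/andP[_ /andP[_ /super_dominatingP sdAB]] uB].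
  case: pickP => [v /andP[vAB /eqP vu]|nov] //=; first by rewrite -in_setU.
  have [|v vAB vu] := sdAB u; first by rewrite inE negb_or uA.
  by move: (nov v); rewrite vAB vu eqxx.
have f_inj : {in Q' &, injective f}.
  move=> B C BQ CQ eqf; have [fB uB] := fP B BQ; have [fC uC] := fP C CQ.
  move: fB fC uB uC; rewrite -eqf; move: (f B) => v vAB vAC uB uC.
  have [BP CP] : B \in P /\ C \in P.
    by move: BQ CQ; rewrite !inE => /andP[/andP[-> _] _] /andP[/andP[-> _] _].
  apply/eqP; apply: contraT => neqBC.
  (* For distinct [B] and [C] the two unions meet only in [A]. So a shared [v] lies in [A], and a
     neighbour of [v] other than [u] lies in both unions, hence in [A]: [v] serves [u] for [A]
     alone, against the choice of [u]. *)
  have BC x : x \in A :|: B -> x \in A :|: C -> x \in A.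
    rewrite !inE => /orP[-> //|xB] /orP[-> //|xC].
    by rewrite (disjoint_parts x tP BP CP xB xC) eqxx in neqBC.
  have /negP[] := no_v v (BC v vAB vAC).
  rewrite eqEsubset; apply/andP; split; apply/subsetP => w.
    rewrite in_setI in_setC => /andP[vw wA]; apply: contraR wA => wu.
    apply: BC; apply: contraR wu => wAX.
      by rewrite -uB in_setI vw in_setC.
    by rewrite -uC in_setI vw in_setC.
  move=> wu; move: (wu); rewrite -uB in_setI => /andP[vw _].
  by rewrite in_setI vw in_setC (set1P wu).
have cardQ' : #|Q'| <= d.
  rewrite -(card_in_imset f_inj); apply: leq_trans (degG u).
  apply/subset_leq_card/subsetP => _ /imsetP[B /fP[_ fB] ->].
  by move/setP/(_ u): fB; rewrite !inE eqxx adj_sym => /andP[].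
rewrite -/Q -(cardsID [set B : {set G} | u \in B] Q) -add1n.
apply: leq_add.
  by apply: leq_trans uniq_u; apply/subset_leq_card/subsetP => B; rewrite !inE.
apply: leq_trans cardQ'; apply/subset_leq_card/subsetP => B.
by rewrite !inE andbC.
Qed.

Lemma no_disjoint_coalitions (G : sgraph) (P : {set {set G}})
    (A B C D : {set G}) :
  partition P [set: G] -> 4 < #|P| -> uniq [:: A; B; C; D] ->
  {subset [:: A; B; C; D] <= P} ->
  super_dominating (A :|: B) -> super_dominating (C :|: D) -> False.
Proof.
move=> partP P5 uABCD sABCD /super_dominating_card AB /super_dominating_card CD.
have cardU (X Y : {set G}) : #|X :|: Y| <= #|X| + #|Y|.
  by rewrite cardsU leq_subr.
pose R := P :\: [set X in [:: A; B; C; D]].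
have /card_gt0P[E ER] : 0 < #|R|.
  rewrite cardsDS; last by apply/subsetP => X; rewrite inE => /sABCD.
  by rewrite cardsE (card_uniqP uABCD) subn_gt0.
have : uniq [:: E; A; B; C; D].
  rewrite cons_uniq uABCD andbT.
  by move: ER; rewrite inE [_ \in finset _]inE => /andP[].
have EP : E \in P by move: ER; rewrite inE => /andP[].
move=> uE.
have E0 : 0 < #|E|.
  by rewrite card_gt0; apply: contraTneq EP => ->; case/and3P: partP.
have : \sum_(X <- [:: E; A; B; C; D]) #|X| <= #|G|.
  rewrite -cardsT (card_partition partP) big_uniq //.
  rewrite [X in _ <= X](bigID [in [:: E; A; B; C; D]]) /=.
  apply: leq_trans (leq_addr _ _); rewrite leq_eqVlt; apply/orP; left.
  apply/eqP/eq_bigl => X; case XE: (X \in _); rewrite ?andbF // andbT.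
  by move: XE; rewrite inE => /predU1P[->//|/sABCD ->].
rewrite !big_cons big_nil addn0 !addnA; apply/negP; rewrite -ltnNge.
(* Once doubled, this is the sum of the two half-order bounds; the nonempty fifth part [E] then
   exceeds the order. *)
have: #|G| <= #|A| + #|B| + (#|C| + #|D|).
  rewrite -(leq_pmul2l (isT : 0 < 2)) mulnDr mul2n -addnn.
  by apply: leq_add; [apply: leq_trans AB _|apply: leq_trans CD _];
    rewrite leq_mul2l cardU.
by move=> /leq_ltn_trans; apply; rewrite -!addnA -[X in X < _]add0n ltn_add2r.
Qed.

Lemma coalition_star (G : sgraph) (P : {set {set G}}) :
  super_coalition_partition P -> 4 < #|P| ->
  exists2 A, A \in P & P :\ A \subset coalition_partners G P A.
Proof.
move=> /and3P[partP _ /forall_inP coal] P5.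
have mate X : X \in P ->
    exists2 Y, Y \in P & (Y != X) && super_dominating (X :|: Y).
  by move=> /coal/exists_inP[Y YP XY]; exists Y.
have /card_gt0P[A0 A0P] : 0 < #|P| by apply: leq_trans P5.
have [B0 B0P /andP[neqBA0 sdAB0]] := mate A0 A0P.
have /card_gt0P[C] : 0 < #|P :\: [set A0; B0]|.
  rewrite cardsDS; last by apply/subsetP => X /set2P[] ->.
  by rewrite subn_gt0 cards2; apply: leq_ltn_trans P5; case: (_ != _).
rewrite !inE negb_or => /andP[/andP[CA0 CB0] CP].
have [X XP /andP[neqXC sdCX]] := mate C CP.
(* The mate [X] of [C] must be [A0] or [B0], else the two pairs are disjoint. [A] is this common
   part, the future center, and [B] the other one. *)
have [A [B [AP [BP [neqAB [neqCA [neqCB [sdAB sdAC]]]]]]]] :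
    exists A B, A \in P /\ B \in P /\ A != B /\ C != A /\ C != B /\
      super_dominating (A :|: B) /\ super_dominating (A :|: C).
  have [XA0|XA0] := eqVneq X A0.
    exists A0, B0; do !split=> //; first by rewrite eq_sym.
    by rewrite setUC -XA0.
  have [XB0|XB0] := eqVneq X B0.
    by exists B0, A0; do !split=> //; rewrite setUC // -XB0.
  exfalso; apply: (@no_disjoint_coalitions G P A0 B0 C X) => //.
    by rewrite /= !inE !negb_or; do ![apply/andP; split] => //; rewrite eq_sym.
  by apply/allP; rewrite /= A0P B0P CP XP.
exists A => //; apply/subsetP => D; rewrite !inE => /andP[DA DP].
rewrite DA DP /=.
have [-> //|DB] := eqVneq D B; have [-> //|DC] := eqVneq D C.
have [Y YP /andP[YD sdDY]] := mate D DP.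
have [<-|YA] := eqVneq Y A; first by rewrite setUC.
(* A mate [Y] other than [A] gives disjoint pairs: [D], [B] against [A], [C] if [Y] is [B], and
   otherwise, even for [Y = C], [D], [Y] against [A], [B]. *)
exfalso; have [YB|YB] := eqVneq Y B.
  rewrite YB in YD sdDY; apply: (@no_disjoint_coalitions G P A C D B) => //.
    by rewrite /= !inE !negb_or; do ![apply/andP; split] => //; rewrite eq_sym.
  by apply/allP; rewrite /= AP CP DP BP.
apply: (@no_disjoint_coalitions G P A B D Y) => //.
  by rewrite /= !inE !negb_or; do ![apply/andP; split] => //; rewrite eq_sym.
by apply/allP; rewrite /= AP BP DP YP.
Qed.

(** From five parts on, there is a center with at most [d.+1] leaves; up to four parts, [1 < d]
    suffices. *)
Lemma card_super_coalition_partition (G : sgraph) (d : nat)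
    (P : {set {set G}}) :
  1 < d -> (forall v : G, #|nbh v| <= d) ->
  super_coalition_partition P -> #|P| <= d.+2.
Proof.
move=> d2 degG scP; have [P4|P5] := leqP #|P| 4; first exact: leq_trans P4 _.
have [A AP star] := coalition_star G P scP P5.
case/and3P: scP => /and3P[_ tP _] /forall_inP notsd _.
rewrite (cardsD1 A) AP add1n ltnS.
apply: leq_trans (card_coalition_partners G d P A degG tP (notsd A AP)).
exact: subset_leq_card.
Qed.

Lemma path_degree (n : nat) (v : path_graph n) : #|nbh v| <= 2.
Proof.
(* At an end of the path one of these two values is not a neighbour, which is harmless for an upper
   bound. *)
rewrite cardE -(size_map val) -[2]/(size [:: v.-1; v.+1]).
apply: uniq_leq_size; first by rewrite (map_inj_uniq val_inj) enum_uniq.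
move=> _ /mapP[u uv ->]; move: uv; rewrite mem_enum !inE /= /path_adj.
by case/orP=> /eqP <-; rewrite eqxx ?orbT.
Qed.

(** [R], the rest of the path, is a partner of both singletons: in the complement of [x1] the end
    [x0] serves [x1], and in the complement of [x0] the vertex [x1] serves [x0]. *)
Lemma super_coalition_path (n : nat) :
  exists2 P : {set {set path_graph n.+3}},
    super_coalition_partition P & #|P| = 3.
Proof.
pose x0 : path_graph n.+3 := inord 0; pose x1 : path_graph n.+3 := inord 1.
pose x2 : path_graph n.+3 := inord 2.
have v0 : val x0 = 0 by rewrite /= inordK.
have v1 : val x1 = 1 by rewrite /= inordK.
have v2 : val x2 = 2 by rewrite /= inordK.
have x01 : x0 != x1 by rewrite -val_eqE v0 v1.
have x02 : x0 != x2 by rewrite -val_eqE v0 v2.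
have x12 : x1 != x2 by rewrite -val_eqE v1 v2.
have adj0 u : adj x0 u = (u == x1).
  rewrite -(inj_eq val_inj) v1 /= /path_adj -[nat_of_ord x0]/(val x0) v0.
  by rewrite orbF eq_sym.
have adj1 u : adj x1 u = (u == x0) || (u == x2).
  rewrite -!(inj_eq val_inj) v0 v2 /= /path_adj -[nat_of_ord x1]/(val x1) v1.
  by rewrite eqSS orbC !(eq_sym 2).
pose R := ~: [set x0; x1].
have sd0 : super_dominating (~: [set x0]).
  apply/super_dominatingP => u; rewrite !inE negbK => /eqP ->.
  exists x1; first by rewrite !inE eq_sym.
  apply/setP => w; rewrite !inE negbK adj1.
  by case: (w == x0); rewrite ?andbF.
have sd1 : super_dominating (~: [set x1]).
  apply/super_dominatingP => u; rewrite !inE negbK => /eqP ->.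
  exists x0; first by rewrite !inE.
  by apply/setP => w; rewrite !inE negbK adj0 andbb.
(* The failures: [x2] is not adjacent to [x0]; [x1] has both [x0] and [x2] outside its singleton;
   the only neighbour of [x0] is [x1], which is not in [R]. *)
have nsd0 : ~~ super_dominating [set x0].
  apply/negP => /super_dominatingP/(_ x2).
  rewrite !inE eq_sym => /(_ x02)[v /set1P -> /setP/(_ x2)].
  by rewrite !inE adj0 eqxx eq_sym (negPf x12).
have nsd1 : ~~ super_dominating [set x1].
  apply/negP => /super_dominatingP/(_ x0).
  rewrite !inE => /(_ x01)[v /set1P -> /setP/(_ x2)].
  by rewrite !inE adj1 eqxx orbT !(eq_sym x2) x12 (negPf x02).
have nsdR : ~~ super_dominating R.
  apply/negP => /super_dominatingP/(_ x0).
  rewrite !inE eqxx => /(_ isT)[v vR /setP/(_ x0)].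
  rewrite !inE eqxx adj_sym adj0 andbT => /eqP vx1.
  by move: vR; rewrite vx1 !inE eqxx orbT.
have R01 : [set x0] :|: R = ~: [set x1].
  by apply/setP => w; rewrite !inE; case: (eqVneq w x0) => [->|].
have R10 : [set x1] :|: R = ~: [set x0].
  by apply/setP => w; rewrite !inE; case: (eqVneq w x1) => [->|];
    rewrite ?orbF ?(eq_sym x1).
have x2R : x2 \in R by rewrite !inE !(eq_sym x2) negb_or x02.
have neq01 : [set x0] != [set x1] :> {set _} by rewrite (inj_eq set1_inj).
have neq0R : [set x0] != R.
  by apply: contraNneq x02 => eqR; move: x2R; rewrite -eqR inE eq_sym.
have neq1R : [set x1] != R.
  by apply: contraNneq x12 => eqR; move: x2R; rewrite -eqR inE eq_sym.
pose P : {set {set path_graph n.+3}} := [set [set x0]; [set x1]; R].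
(* Case analysis over the three parts for an arbitrary predicate, so that it can be nested for pairs
   of parts. *)
have inP (Q : {set path_graph n.+3} -> Prop) :
    Q [set x0] -> Q [set x1] -> Q R -> forall A, A \in P -> Q A.
  by move=> Q0 Q1 QR A; rewrite !inE => /orP[/orP[]|] /eqP ->.
exists P; last first.
  rewrite -[P]setUC cardsU1 cards2 neq01 !inE negb_or.
  by rewrite !(eq_sym R) neq0R neq1R.
apply/and3P; split.
- apply/and3P; split.
  + rewrite eqEsubset subsetT; apply/subsetP => w _; apply/bigcupP.
    have [w0|w0] := eqVneq w x0.
      by exists [set x0]; rewrite !inE ?w0 eqxx.
    have [w1|w1] := eqVneq w x1.
      by exists [set x1]; rewrite !inE ?w1 eqxx ?orbT.
    by exists R; rewrite !inE ?negb_or ?w0 ?eqxx ?orbT.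
  + have d01 : [disjoint [set x0] & [set x1]] by rewrite disjoints1 inE.
    have d0R : [disjoint [set x0] & R] by rewrite disjoints1 !inE eqxx.
    have d1R : [disjoint [set x1] & R] by rewrite disjoints1 !inE eqxx orbT.
    apply/trivIsetP => A B AP; move: B; move: A AP.
    by apply: (inP); apply: (inP); rewrite ?eqxx // disjoint_sym.
  + by rewrite !inE !(eq_sym set0); apply/norP; split; [apply/norP; split|];
      apply/set0Pn; [exists x0|exists x1|exists x2]; rewrite // inE.
- by apply/forall_inP; apply: inP.
- have RP : R \in P by rewrite !inE eqxx !orbT.
  apply/forall_inP; apply: inP; apply/exists_inP.
  + by exists R; rewrite // eq_sym neq0R R01.
  + by exists R; rewrite // eq_sym neq1R R10.
  + by exists [set x0]; rewrite ?neq0R 1?setUC ?R01 // !inE eqxx.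
Qed.

Theorem theorem5p1 (n : nat) (hn : 3 <= n) :
  3 <= super_coalition_number (path_graph n) <= 4.
Proof.
apply/andP; split.
  case: n hn => [|[|[|n]]] // _; have [P scP <-] := super_coalition_path n.
  exact: (leq_bigmax_cond _ scP).
apply/bigmax_leqP => P; apply: card_super_coalition_partition => //.
exact: path_degree.
Qed.
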